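(* Let $X$ be a second-countable Hausdorff topological space. Then $X$ is symmetrizable if and only if $X$ is perfect.
   Context: A symmetric on a set $X$ is a function $d:X\times X\to[0,\infty)$ such that for all $x,y\in X$: (1) $d(x,y)=0$ if and only if $x=y$; (2) $d(x,y)=d(y,x)$. (No triangle inequality is required.) For $x\in X$ and $\varepsilon>0$ put $B_d(x;\varepsilon)=\{y\in X:d(x,y)<\varepsilon\}$. The topology of a topological space $X$ is generated by $d$ if a subset $U\subseteq X$ is open if and only if for every $x\in U$ there exists $\varepsilon>0$ such that $B_d(x;\varepsilon)\subseteq U$. A topological space is symmetrizable if its topology is generated by some symmetric. A topological space $X$ is perfect if every closed subset of $X$ is of type $G_\delta$, i.e. is the intersection of countably many open sets of $X$. *)

(* Defs.v *)
From mathcomp Require Import all_boot all_order all_algebra.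
From mathcomp Require Import classical_sets reals topology borel_hierarchy.

Set Implicit Arguments.
Unset Strict Implicit.
Unset Printing Implicit Defensive.

Import Order.TTheory GRing.Theory Num.Theory.

Local Open Scope classical_set_scope.
Local Open Scope ring_scope.

Record is_symmetric (R : realType) (X : Type) (d : X -> X -> R) : Prop :=
  IsSymmetric {
    symm_ge0 : forall x y, 0 <= d x y;
    symm_eq0 : forall x y, d x y = 0 <-> x = y;
    symmC : forall x y, d x y = d y x
  }.

(* The library's [ball] belongs to pseudometric spaces; here [d] need not
   satisfy the triangle inequality, and the balls need not be open. *)
Definition symm_ball (R : realType) (X : Type) (d : X -> X -> R)
  (x : X) (e : R) : set X := [set y | d x y < e].

Definition topology_generated_by (R : realType) (X : topologicalType)
    (d : X -> X -> R) : Prop :=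
  forall U : set X, open U <->
    forall x, U x -> exists2 e : R, 0 < e & symm_ball d x e `<=` U.

Definition symmetrizable (R : realType) (X : topologicalType) : Prop :=
  exists2 d : X -> X -> R, is_symmetric d & topology_generated_by d.

(* Unrelated to the library's [perfect_set] (closed without isolated points). *)
Definition perfect_space (X : topologicalType) : Prop :=
  forall A : set X, closed A -> Gdelta A.

(* Main.v *)
Require Import Defs.
From mathcomp Require Import all_boot all_order all_algebra.
From mathcomp Require Import classical_sets reals topology borel_hierarchy.
From mathcomp Require Import boolp functions cardinality.

(** From symmetric to perfect.  The balls of a symmetric that generates the
    topology need not be neighbourhoods of their centres, but they are in a
    first-countable Hausdorff space ([nbhs_symm_ball]): a sequence converging
    to [x] outside the ball around [x] would have a closed range that is not
    closed.  A closed set [A] is then the intersection over [n] of the unions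
    of the interiors of the balls of radius [1 / n.+1] centred in [A]: a point
    outside [A] has a ball that misses [A], and, by symmetry of [d], it lies in
    no ball of smaller radius centred in [A]
    ([perfect_of_first_countable_symmetrizable]).

    From perfect to symmetric.  Let [B] be a countable base and write each
    [B n], an F-sigma set by perfectness, as the union of closed sets [F n m].
    The points [y] that lie in every [B n] containing [x], [n < k], and outside
    every [F n m] with [x] not in [B n], [n, m < k], form a neighbourhood
    [base_nbhs B F k x] of [x] that shrinks as [k] grows.  Take [x] and [y] to
    be close at scale [k] when one of them lies in the neighbourhood of the
    other.  If [x] lies in [B n], hence in some [F n m], then every [y] close to
    [x] at a scale beyond [n] and [m] lies in [B n]: this is the first condition
    when [y] is in the neighbourhood of [x], and the second one when [x] is in
    the neighbourhood of [y].  Hence these relations generate the topology, and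
    they are turned into a symmetric by [symmetrizable_of_scales]. *)

Set Implicit Arguments.
Unset Strict Implicit.
Unset Printing Implicit Defensive.

Import Order.TTheory GRing.Theory Num.Theory.

Local Open Scope classical_set_scope.
Local Open Scope ring_scope.

Definition first_countable (X : topologicalType) : Prop :=
  forall x : X, exists2 W : nat -> set X,
    forall n, nbhs x (W n) & forall U, nbhs x U -> exists n, W n `<=` U.

Lemma second_countable_sequence (X : topologicalType) :
  @second_countable X ->
  exists2 B : nat -> set X, forall n, open (B n) &
    forall x U, nbhs x U -> exists2 n, B n x & B n `<=` U.
Proof.
case=> C /pfcard_geP[->|/unsquash f] [Copen Cbase].
  (* Only the empty space has an empty base. *)
  exists (fun=> setT) => [_|x U /Cbase[V []//]]; exact: openT.
exists f => [n|x U /Cbase[V [CV Vx] VU]]; first by apply: Copen; exact: funS.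
have [n _ fn] : (f @` setT) V by exact: surj.
by exists n; rewrite fn.
Qed.

Lemma first_countable_of_second_countable (X : topologicalType) :
  @second_countable X -> first_countable X.
Proof.
move=> /second_countable_sequence[B Bopen Bbase] x.
exists (fun n => [set y | B n x -> B n y]).
  move=> n; have [Bnx|nBnx] := pselect (B n x); last first.
    by apply: filterS filterT => y _.
  by apply: filterS (open_nbhs_nbhs (conj (Bopen n) Bnx)) => y Bny _.
move=> U /Bbase[n Bnx BU]; exists n => y /= /(_ Bnx); exact: BU.
Qed.

(** If the ball were not a neighbourhood of [x], some [y n] outside it would
    converge to [x].  By Hausdorffness the range of [y] accumulates only at
    [x], and the ball around [x] misses it; so every point of its complement
    has a ball missing it.  The range would thus be closed although [y]
    converges to the point [x] outside it. *)
Lemma nbhs_symm_ball (R : realType) (X : topologicalType) (d : X -> X -> R) :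
  is_symmetric d -> topology_generated_by d ->
  hausdorff_space X -> first_countable X ->
  forall x e, 0 < e -> nbhs x (symm_ball d x e).
Proof.
move=> dsym dgen hX fcX x e e0; apply: contrapT => nball.
have [W Wx Wbase] := fcX x.
have /choice[y yP] : forall n, exists y,
    (forall i : 'I_n, W i y) /\ ~ symm_ball d x e y.
  move=> n; apply: contrapT => noy; apply: nball.
  have /= : nbhs x [set y | forall i : 'I_n, W i y].
    by apply: filter_forall => i; exact: Wx.
  apply: filterS => z Wz.
  by apply: contrapT => nz; apply: noy; exists z.
have T1 := hausdorff_accessible hX.
have sep := hX; rewrite open_hausdorff in sep.
have yx : ~ range y x.
  move=> [n _ ynx]; have [_] := yP n; apply.
  by rewrite /symm_ball /= ynx (symm_eq0 dsym x x).2.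
have oS : open (~` range y).
  apply/dgen => z /= Sz; have [->|/eqP zx] := pselect (z = x).
    by exists e => // u xu [n _ ynu]; have [_] := yP n; apply; rewrite ynu.
  have [[A C] /= [/set_mem Az /set_mem Cx] [oA oC /eqP AC0]] := sep z x zx.
  have [N WNC] := Wbase C (open_nbhs_nbhs (conj oC Cx)).
  (* Beyond index [N] the sequence is in [C], hence outside [A]. *)
  have oD : open (A `&` ~` (y @` `I_N.+1)).
    apply: openI => //; apply: closed_openC.
    apply: accessible_finite_set_closed.1 => //.
    exact: finite_image.
  have [|r r0 rD] := (dgen _).1 oD z.
    by split=> // -[n _ ynz]; apply: Sz; exists n.
  exists r => // u /rD[Au yu] [n _ ynu].
  have [nN|Nn] := ltnP n N.+1; first by apply: yu; exists n.
  suff: (A `&` C) u by rewrite AC0.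
  by split=> //; apply: WNC; rewrite -ynu; exact: ((yP n).1 (Ordinal Nn)).
have [n WnS] := Wbase _ (open_nbhs_nbhs (conj oS yx)).
by apply: (WnS (y n.+1)); [exact: ((yP n.+1).1 ord_max) | exists n.+1].
Qed.

Lemma perfect_of_first_countable_symmetrizable (R : realType)
    (X : topologicalType) :
  hausdorff_space X -> first_countable X ->
  symmetrizable R X -> perfect_space X.
Proof.
move=> hX fcX [d dsym dgen] A cA.
pose r (n : nat) : R := n.+1%:R^-1.
have r0 n : 0 < r n by rewrite invr_gt0.
exists (fun n => \bigcup_(x in A) interior (symm_ball d x (r n))).
  by move=> n; apply: bigcup_open => x _; exact: open_interior.
apply/seteqP; split=> [x Ax n _|y yG].
  by exists x => //; exact: (nbhs_symm_ball dsym dgen).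
apply: contrapT => nAy.
have [e e0 eA] := (dgen _).1 (closed_openC cA) y nAy.
have [n] := ltr_add_invr e0; rewrite add0r => ne.
have [x Ax /interior_subset xy] := yG n I.
apply: (eA x) => //.
by rewrite /symm_ball /= (symmC dsym); apply: lt_trans ne.
Qed.

(** Separates the construction of a symmetric from its values in [R].  With
    [d x y] the infimum of the [1 / k.+1] such that [P k x y], monotonicity in
    [k] sandwiches each relation, [d x y < 1 / k.+1 -> P k x y] and
    [P k x y -> d x y <= 1 / k.+1], so the balls of [d] and the sets [P k x]
    generate the same topology. *)
Lemma symmetrizable_of_scales (R : realType) (X : topologicalType)
    (P : nat -> X -> X -> Prop) :
  (forall k x, P k x x) ->
  (forall k x y, P k x y -> P k y x) ->
  (forall j k x y, (j <= k)%N -> P k x y -> P j x y) ->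
  (forall x y, (forall k, P k x y) -> x = y) ->
  (forall U, open U <-> forall x, U x -> exists k, P k x `<=` U) ->
  symmetrizable R X.
Proof.
move=> Prefl Psym Panti Psep Pgen.
pose r (n : nat) : R := n.+1%:R^-1.
have r0 n : 0 < r n by rewrite invr_gt0.
(* The value [1] keeps the set nonempty when no relation holds. *)
pose E x y : set R := [set 1] `|` r @` [set k | P k x y].
pose d x y := inf (E x y).
have E0 x y : lbound (E x y) 0.
  by move=> t [->|[k _ <-]]; [exact: ler01 | exact/ltW].
have En0 x y : E x y !=set0 by exists 1; left.
have d0 x y : 0 <= d x y by apply: lb_le_inf.
have dle k x y : P k x y -> d x y <= r k.
  move=> Pk; apply: ge_inf; first by exists 0.
  by right; exists k.
have dlt k x y : d x y < r k -> P k x y.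
  move=> /(inf_lt (En0 x y))[t [->|[j Pj <-]]].
    by rewrite ltNge invf_le1 ?ler1n.
  by rewrite ltf_pV2 ?posrE// ltr_nat ltnS => /ltnW /Panti; apply.
exists d.
  split=> // x y; last first.
    by congr inf; congr (_ `|` _ @` _); apply/seteqP; split=> k; exact: Psym.
  split=> [dxy|->]; first by apply: Psep => k; apply: dlt; rewrite dxy.
  apply/eqP; rewrite eq_le d0 andbT leNgt; apply/negP => /ltr_add_invr[k].
  by rewrite add0r ltNge dle.
move=> U; rewrite Pgen; split=> PU x /PU.
  move=> [k kU]; exists (r k) => // y /dlt; exact: kU.
move=> [e e0 eU]; have [k] := ltr_add_invr e0; rewrite add0r => ke.
by exists k => y /dle xy; apply: eU; apply: le_lt_trans ke.
Qed.

(** The condition on [F] is the contrapositive of: a point outside [B n] keeps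
    away from each [F n m].  It is in this form that it applies to the centre
    when the roles of centre and neighbour are exchanged. *)
Definition base_nbhs (X : Type) (B : nat -> set X) (F : nat -> nat -> set X)
    (k : nat) (x : X) : set X :=
  [set y | forall n : 'I_k, (B n x -> B n y) /\
                            forall m : 'I_k, F n m y -> B n x].

Lemma nbhs_base_nbhs (X : topologicalType) (B : nat -> set X)
    (F : nat -> nat -> set X) k x :
  (forall n, open (B n)) -> (forall n m, closed (F n m)) ->
  (forall n m, F n m `<=` B n) -> nbhs x (base_nbhs B F k x).
Proof.
move=> Bopen Fclosed FB; apply: filter_forall => n.
have [Bnx|nBnx] := pselect (B n x).
  by apply: filterS (open_nbhs_nbhs (conj (Bopen n) Bnx)) => y Bny; split.
have : nbhs x [set y | forall m : 'I_k, ~ F n m y].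
  apply: filter_forall => m; apply: open_nbhs_nbhs; split.
    exact: closed_openC.
  by move=> /FB.
by apply: filterS => y nF; split=> // m /nF.
Qed.

Lemma symmetrizable_of_perfect (R : realType) (X : topologicalType) :
  accessible_space X -> @second_countable X ->
  perfect_space X -> symmetrizable R X.
Proof.
move=> T1 /second_countable_sequence[B Bopen Bbase] Xperf.
have /choice[F FP] : forall n, exists F : nat -> set X,
    (forall m, closed (F m)) /\ B n = \bigcup_m F m.
  move=> n; have [G Gopen BG] := Xperf _ (open_closedC (Bopen n)).
  exists (fun m => ~` G m); split=> [m|]; first exact: open_closedC.
  by rewrite -setC_bigcap -BG setCK.
have FB n m : F n m `<=` B n by rewrite (FP n).2 => x Fx; exists m.
pose V := base_nbhs B F.
have Vxx k x : V k x x by move=> n; split=> // m /FB.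
have Vanti j k x y : (j <= k)%N -> V k x y -> V j x y.
  move=> jk Vk n; have [Bxy Fyx] := Vk (widen_ord jk n).
  by split=> // m; exact: (Fyx (widen_ord jk m)).
have Pbase x U : nbhs x U ->
    exists k, [set y | V k x y \/ V k y x] `<=` U.
  move=> /Bbase[n Bnx BU]; have := Bnx; rewrite (FP n).2 => -[m _ Fx].
  have ltn : (n < (maxn n m).+1)%N by rewrite ltnS leq_maxl.
  have ltm : (m < (maxn n m).+1)%N by rewrite ltnS leq_maxr.
  exists (maxn n m).+1 => y [] /(_ (Ordinal ltn))[Bimp Fimp]; apply: BU.
    exact: Bimp.
  exact: (Fimp (Ordinal ltm)).
apply: (@symmetrizable_of_scales R X (fun k x y => V k x y \/ V k y x)).
- by move=> k x; left.
- by move=> k x y; rewrite or_comm.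
- by move=> j k x y jk [] /(Vanti _ _ _ _ jk); [left|right].
- move=> x y Pxy; apply: contrapT => xy.
  have [|k kU] := Pbase x (~` [set y]).
    apply: open_nbhs_nbhs; split=> //; apply: closed_openC.
    exact: accessible_closed_set1.
  exact: (kU y (Pxy k)).
- move=> U; split=> [oU x Ux|PU].
    by apply: Pbase; exact: open_nbhs_nbhs.
  rewrite openE => x /PU[k kU].
  have : nbhs x (V k x) by apply: nbhs_base_nbhs => // n; exact: (FP n).1.
  by apply: filterS => y Vy; apply: kU; left.
Qed.

Theorem theorem6 (R : realType) (X : topologicalType)
  (X_second_countable : @second_countable X)
  (X_hausdorff : hausdorff_space X) :
  symmetrizable R X <-> perfect_space X.
Proof.
split.
  apply: perfect_of_first_countable_symmetrizable => //.
  exact: first_countable_of_second_countable.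
by apply: symmetrizable_of_perfect => //; exact: hausdorff_accessible.
Qed.
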